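(* Let $f(z)=\dfrac{z^3+a_1z+a_0}{z^2+b_1z+b_0}$ be a rational function (with complex coefficients) with $4$ distinct critical points. Denote by $\Delta$ the cross ratio of these four points. Then the following are equivalent: (i) the associated Schwarzian derivative $S_f$ depends locally holomorphically on the $4$ critical points; (ii) $a_1+3b_0\ne 0$; (iii) $\Delta\notin\left\{\dfrac{1+i\sqrt3}{2},\dfrac{1-i\sqrt3}{2}\right\}$.
   Context: $S_f=\frac{f'''}{f'}-\frac32\left(\frac{f''}{f'}\right)^2$ is the Schwarzian derivative. Cross ratio: for an ordered quadruple of distinct points, $[a,b,c,d]=\frac{(a-c)(b-d)}{(c-b)(d-a)}$. $\Delta$ is computed using any ordering of the four critical points; condition (iii) does not depend on the ordering. Meaning of (i): write $\mathbf a=(a_0,a_1,b_0,b_1)\in\mathbb C^4$ and $f_{\mathbf a}(z)=\frac{z^3+a_1z+a_0}{z^2+b_1z+b_0}$. For $\mathbf a$ such that $f_{\mathbf a}$ has four distinct critical points (they are then all finite), let $\mathbf c=(c_1,c_2,c_3,c_4)\in\mathbb C^4$ be the vector of critical points in some ordering. On this set of parameters the map $\mathbf a\mapsto S_{f_{\mathbf a}}$ is injective, and a local continuous choice of ordering makes $\mathbf a\mapsto\mathbf c$ a holomorphic map. Statement (i) means that this map is locally invertible at the given parameter, i.e. in a neighborhood of the vector $\mathbf c^0$ of critical points of $f$ there is a holomorphic map $\mathbf c\mapsto\mathbf a(\mathbf c)$ such that $f_{\mathbf a(\mathbf c^0)}=f$ and $f_{\mathbf a(\mathbf c)}$ has critical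 points $c_1,\dots,c_4$; so that $\mathbf c\mapsto S_{f_{\mathbf a(\mathbf c)}}$ is a holomorphic branch through $S_f$. *)

(* Defs.v *)
From HB Require Import structures.
From mathcomp Require Import all_boot all_order all_algebra.
From mathcomp Require Import complex.
From mathcomp Require Import all_classical all_reals all_analysis.

Set Implicit Arguments.
Unset Strict Implicit.
Unset Printing Implicit Defensive.

Import Order.TTheory GRing.Theory Num.Theory.
Import numFieldNormedType.Exports.

Local Open Scope classical_set_scope.
Local Open Scope complex_scope.
Local Open Scope ring_scope.

(* C as a normed space over itself, not over R; the library has this instance
   only for abstract fields. *)
HB.instance Definition _ (R : realType) := NormedModule.copy R[i] R[i]^o.

Section Defs.
Variable R : realType.
Local Notation C := R[i].

Definition schwarzian (f : C -> C) (z : C) : C :=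
  derive1n 3 f z / derive1 f z
    - 3 / 2 * (derive1n 2 f z / derive1 f z) ^+ 2.

Definition ratfun (p q : {poly C}) (z : C) : C := p.[z] / q.[z].

(* Critical points, in the finite plane, of the rational map p/q into the
   Riemann sphere. The fraction is first reduced; at a pole the derivative is
   taken in the chart 1/w of the target. *)
Definition critical_point (p q : {poly C}) (z : C) : Prop :=
  let p1 := p %/ gcdp p q in
  let q1 := q %/ gcdp p q in
  if q1.[z] != 0 then derive1 (ratfun p1 q1) z = 0
  else derive1 (ratfun q1 p1) z = 0.

(* The parameter (a_0, a_1, b_0, b_1) is a row vector in this order. *)
Definition vec4 (x0 x1 x2 x3 : C) : 'rV[C]_4 :=
  \row_(i < 4) [:: x0; x1; x2; x3]`_i.

Definition fnum (a : 'rV[C]_4) : {poly C} :=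
  'X^3 + a 0 1 *: 'X + (a 0 0)%:P.

Definition fden (a : 'rV[C]_4) : {poly C} :=
  'X^2 + a 0 3 *: 'X + (a 0 2)%:P.

Definition fpar (a : 'rV[C]_4) : C -> C := ratfun (fnum a) (fden a).

(* c lists the critical points of fpar a, which are four distinct points.
   Infinity need not be considered: fpar a z ~ z there, so it is never
   critical. *)
Definition critical_vector (a c : 'rV[C]_4) : Prop :=
  injective (c 0) /\
  (forall z, critical_point (fnum a) (fden a) z <-> exists i, z = c 0 i).

Definition cross_ratio (a b c d : C) : C :=
  ((a - c) * (b - d)) / ((c - b) * (d - a)).

(* Holomorphy of maps out of C^4 is C-linear (Frechet) differentiability on an
   open set. The branch c |-> schwarzian (fpar (A c)) is evaluated at the
   points z where both fpar (A c) and its Schwarzian derivative, as given by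
   the formula, have no pole. *)
Definition schwarzian_locally_holomorphic (a c : 'rV[C]_4) : Prop :=
  exists A : 'rV[C]_4 -> 'rV[C]_4,
    [/\ A c = a,
        \forall x \near c, differentiable A x,
        \forall x \near c, critical_vector (A x) x
      & \forall x \near c, forall z : C,
          (fden (A x)).[z] != 0 -> derive1 (fpar (A x)) z != 0 ->
          differentiable (fun y => schwarzian (fpar (A y)) z) x].

End Defs.

(* Main.v *)
Require Import Defs.
From HB Require Import structures.
From mathcomp Require Import all_boot all_order all_algebra.
From mathcomp Require Import separable complex ring.
From mathcomp Require Import all_classical all_reals all_analysis.

Set Implicit Arguments.
Unset Strict Implicit.
Unset Printing Implicit Defensive.

Import Order.TTheory GRing.Theory Num.Theory.
Import numFieldNormedType.Exports.

Local Open Scope classical_set_scope.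
Local Open Scope complex_scope.
Local Open Scope ring_scope.

(** Write the map as P / Q with P = z^3 + a1 z + a0 and Q = z^2 + b1 z + b0.
Its critical points are the roots of the Wronskian W = P' Q - P Q', a monic
quartic, so having critical points c0, ..., c3 amounts to W = prod (X - ci).
A factor common to P and Q would enter W squared; since W has simple roots the
fraction is automatically reduced ([critical_vectorP]). Comparing coefficients,
with ei the elementary symmetric functions of the critical points,
<<
  2 b1 = - e1,  3 b0 - a1 = e2,  2 a0 = e3,  a1 b0 - a0 b1 = e4.
>>
Three of these equations are linear; eliminating, what remains is a quadratic
equation for b0, which is best written for s = a1 + 3 b0:
<<
  s^2 = I(c),  where I = e2^2 - 3 e1 e3 + 12 e4
>>
is, up to a constant, the invariant of degree 2 of the quartic W. So recovering
the parameters from the critical points is the same as extracting a square root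
of I(c) ([vieta_quartic_I], [vieta_of_sqrt]).

Cross ratio: with y = (c0 - c2)(c3 - c1) and w = (c0 - c3)(c1 - c2), one has
I = y^2 + y w + w^2 and the cross ratio is D = - y / w. Hence I = 0 exactly when
D^2 - D + 1 = 0, that is, when D is a primitive sixth root of unity
([cross_ratio_equianharmonic], [mem_primitive_sixth_roots]).

Holomorphy: if s is nonzero at c, the square root has a holomorphic branch near
I(c), so the parameters are holomorphic in the critical points, and the
Schwarzian, a rational expression in the parameters and z, follows
([holomorphic_of_neq0]). If s vanishes at c, a holomorphic branch would make I
the square of a function that is differentiable and zero at c, so the
derivative of I at c would be zero. But I has degree at most 2 in c0, and its
discriminant as a quadratic in c0 is - 3 ((c1 - c2)(c2 - c3)(c3 - c1))^2, which
is nonzero for distinct points, so its zeros in c0 are simple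
([sqr_deriv_quartic_I], [neq0_of_holomorphic]). *)

(** * Differentiability and derivatives of rational functions *)

Lemma near_eq_differentiable (K : numFieldType) (V W : normedModType K)
    (f g : V -> W) (x : V) :
  (\forall y \near x, f y = g y) -> differentiable f x -> differentiable g x.
Proof.
move=> fg df.
(* g - f is locally zero, so its differential at x is zero. *)
have d0 : (g - f) \o shift x = cst ((g - f) x) + (0 : V -> W) +o_ 0 id.
  apply/eqaddoP => e e0; near=> h.
  rewrite /= /cst !fctE /=.
  have -> : f x = g x by exact: (nbhs_singleton fg).
  have -> : f (h + x) = g (h + x).
    near: h; move: fg; rewrite [X in X -> _](near_shift 0 x) /=.
    by apply: filterS => h; rewrite /= subr0.
  have -> : (0 : V -> W) h = 0 by [].
  by rewrite !subrr addr0 subr0 normr0 mulr_ge0 // ltW.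
have dgf : differentiable (g - f) x.
  apply/diff_locallyP; rewrite (diff_unique _ d0); last exact: cst_continuous.
  by split; first exact: cst_continuous.
have -> : g = f + (g - f) by apply/funext => y; rewrite !fctE addrC subrK.
exact: differentiableD.
Unshelve. all: by end_near. Qed.

Lemma differentiable_mx (K : numFieldType) (V : normedModType K) m n
    (A : V -> 'M[K]_(m, n)) (x : V) :
  (forall i j, differentiable (fun y => A y i j) x) -> differentiable A x.
Proof.
move=> dA.
have -> : A = \sum_(i < m) \sum_(j < n) (fun y => A y i j *: delta_mx i j).
  apply/funext => y; rewrite [LHS]matrix_sum_delta fct_sumE.
  by apply: eq_bigr => i _; rewrite fct_sumE.
apply: differentiable_sum => i; apply: differentiable_sum => j.
exact: differentiableZl.
Qed.

Section HolomorphicCalculus.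
Variable K : numFieldType.
Implicit Types (p q : {poly K}) (z : K).

Lemma is_derive_horner p z : is_derive z 1 (horner p) p^`().[z].
Proof.
elim/poly_ind: p => [|p c IHp].
  have -> : horner (0 : {poly K}) = cst 0 by apply/funext => y; rewrite horner0.
  by rewrite deriv0 horner0; exact: is_derive_cst.
have -> : horner (p * 'X + c%:P) = horner p * id + cst c.
  by apply/funext => y; rewrite !hornerE.
apply: is_derive_eq; rewrite derivMXaddC !hornerE /GRing.scale/=.
by rewrite mulr1 [z * _]mulrC.
Qed.

Definition wronskian p q := p^`() * q - p * q^`().

Lemma derive1_ratio p q z : q.[z] != 0 ->
  derive1 (fun y => p.[y] / q.[y]) z = (wronskian p q).[z] / (q ^+ 2).[z].
Proof.
move=> qz; rewrite derive1E.
have dp := is_derive_horner p z; have dq := is_derive_horner q z.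
rewrite [LHS](deriveM (@ex_derive _ _ _ _ _ _ _ dp)); last first.
  exact: (derivableV qz (@ex_derive _ _ _ _ _ _ _ dq)).
rewrite (deriveV qz (@ex_derive _ _ _ _ _ _ _ dq)) !derive_val.
rewrite /wronskian horner_exp hornerD hornerN !hornerM.
have quot_rule (a b c d : K) : b != 0 ->
  a * (- b ^- 2 * d) + b^-1 * c = (c * b - a * d) / b ^+ 2 by move=> b0; field.
exact: quot_rule.
Qed.
End HolomorphicCalculus.

(** * A holomorphic branch of the square root *)

Section LocalSquareRoot.
Variables (K : numClosedFieldType) (s0 : K).

(** The square root of w nearer to s0. Comparing distances to s0 and to - s0,
rather than cutting the plane, gives the estimates below directly. *)
Definition sqrt_near (w : K) : K :=
  if `|sqrtC w - s0| <= `|sqrtC w + s0| then sqrtC w else - sqrtC w.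

Lemma sqr_sqrt_near w : sqrt_near w ^+ 2 = w.
Proof. by rewrite /sqrt_near; case: ifP; rewrite ?sqrrN sqrtCK. Qed.

Lemma sqrt_near_closer w : `|sqrt_near w - s0| <= `|sqrt_near w + s0|.
Proof.
rewrite /sqrt_near; case: ifPn => //; rewrite -real_ltNge ?normr_real// => /ltW.
by rewrite -opprD normrN [- _ + _]addrC -[s0 - _]opprB normrN.
Qed.

(** The distances from the chosen root to s0 and - s0 add up to at least
2 |s0|, and the second is the larger one. *)
Lemma norm_center_le w : `|s0| <= `|sqrt_near w + s0|.
Proof.
rewrite -(ler_pM2l (ltr0n K 2)) [leRHS]mulrDl !mul1r.
apply: (@le_trans _ _ (`|sqrt_near w + s0| + `|sqrt_near w - s0|)).
  rewrite -[2%:R]normr_nat -normrM.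
  have -> : 2 * s0 = sqrt_near w + s0 - (sqrt_near w - s0) by ring.
  exact: ler_normB.
by rewrite lerD2l sqrt_near_closer.
Qed.

Lemma sqrt_near_dist w :
  `|sqrt_near w - s0| * `|s0| <= `|w - s0 ^+ 2|.
Proof.
rewrite -[in leRHS](sqr_sqrt_near w) subr_sqr normrM.
by rewrite ler_wpM2l // norm_center_le.
Qed.

Hypothesis s0N0 : s0 != 0.

Lemma sqrt_near_center : sqrt_near (s0 ^+ 2) = s0.
Proof.
have := sqrt_near_dist (s0 ^+ 2); rewrite subrr normr0 -normrM normr_le0.
by rewrite mulf_eq0 (negbTE s0N0) orbF subr_eq0 => /eqP.
Qed.

(** Over the disc of radius |s0|^2 / 2 the chosen root stays within |s0| / 2 of
s0, so a sum of two values stays away from 0. This is what controls the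
difference quotients, as s - t = (s^2 - t^2) / (s + t). *)
Lemma norm_sqrt_near_add_gt w1 w2 :
    `|w1 - s0 ^+ 2| < `|s0| ^+ 2 / 2 -> `|w2 - s0 ^+ 2| < `|s0| ^+ 2 / 2 ->
  `|s0| < `|sqrt_near w1 + sqrt_near w2|.
Proof.
have half w : `|w - s0 ^+ 2| < `|s0| ^+ 2 / 2 -> `|sqrt_near w - s0| < `|s0| / 2.
  move=> /(le_lt_trans (sqrt_near_dist w)).
  by rewrite expr2 mulrAC ltr_pM2r ?normr_gt0.
move=> /half w1s /half w2s.
have : `|s0| + `|s0| <= `|sqrt_near w1 + sqrt_near w2| +
   (`|sqrt_near w1 - s0| + `|sqrt_near w2 - s0|).
  have -> : `|s0| + `|s0| = `|s0 + s0|.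
    by rewrite -mulr2n -[in RHS]mulr2n normrMn.
  have -> : s0 + s0 = sqrt_near w1 + sqrt_near w2
      - (sqrt_near w1 - s0 + (sqrt_near w2 - s0)) by ring.
  by apply: (le_trans (ler_normB _ _)); rewrite lerD2l ler_normD.
move=> /le_lt_trans h; rewrite -(ltrD2r `|s0|); apply: h.
by rewrite ltrD2l [ltRHS]splitr ltrD.
Qed.

(** The difference quotient between w and h + w is the inverse of
sqrt_near (h + w) + sqrt_near w, which tends to (2 sqrt_near w)^-1 by
continuity. *)
Lemma near_derivable_sqrt_near :
  \forall w \near s0 ^+ 2, derivable sqrt_near w 1.
Proof.
pose U w := `|w - s0 ^+ 2| < `|s0| ^+ 2 / 2.
have Unbhs : \forall w \near s0 ^+ 2, U w.
  apply/nbhs_normP; exists (`|s0| ^+ 2 / 2) => /=.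
    by rewrite divr_gt0 // exprn_gt0 // normr_gt0.
  by move=> w /=; rewrite /U distrC.
apply: filterS (nbhs_interior Unbhs) => w Uw.
have Uw0 : U w := nbhs_singleton Uw.
have cs : sqrt_near @ w --> sqrt_near w.
  apply/(@cvgrPdist_lt K K^o K (nbhs w) (nbhs_filter w) sqrt_near) => e e0.
  have wnear : \forall x \near w, `|w - x| < e * `|s0|.
    apply/nbhs_normP; exists (e * `|s0|) => //=.
    by rewrite mulr_gt0 // normr_gt0.
  near=> x.
  have Ux : U x by near: x; exact: Uw.
  rewrite -(ltr_pM2r (_ : 0 < `|s0|)) ?normr_gt0 //.
  apply: (@le_lt_trans _ _ `|w - x|); last first.
    by near: x; exact: wnear.
  rewrite -{2}(sqr_sqrt_near w) -{2}(sqr_sqrt_near x) subr_sqr normrM.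
  by rewrite ler_wpM2l // ltW // norm_sqrt_near_add_gt.
have sum_neq0 x : U x -> sqrt_near x + sqrt_near w != 0.
  by move=> Ux; rewrite -normr_gt0 (le_lt_trans _ (norm_sqrt_near_add_gt Ux Uw0)).
have Ush : \forall h \near (0 : K), U (h + w).
  move: Uw; rewrite /interior /= [X in X -> _](near_shift 0 w) /=.
  by apply: filterS => h; rewrite /= subr0.
have csh : sqrt_near (h + w) @[h --> (0 : K)^'] --> sqrt_near w.
  exact/continuous_withinNshiftx.
apply/cvg_ex; exists (sqrt_near w + sqrt_near w)^-1.
apply: (@cvg_trans _ ((sqrt_near (h + w) + sqrt_near w)^-1 @[h --> 0^'])).
  apply: near_eq_cvg; near=> h.
  have Uh : U (h + w) by near: h; exact: (@cvg_within _ (nbhs (0 : K))).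
  have h0 : h != 0 by near: h; exact: nbhs_dnbhs_neq.
  have {}Uh := sum_neq0 _ Uh.
  set a := sqrt_near (h + w) in Uh *; set b := sqrt_near w in Uh *.
  have hE : h = (a - b) * (a + b) by rewrite -subr_sqr !sqr_sqrt_near addrK.
  have ab0 : a - b != 0 by apply: contraNneq h0; rewrite hE => ->; rewrite mul0r.
  rewrite -[RHS]/(h^-1 * (sqrt_near (h * 1 + w) - b)) mulr1 -/a [in RHS]hE.
  by rewrite invfM mulrAC mulVf // mul1r.
apply: cvgV; first exact: sum_neq0.
apply: cvgD; last exact: cvg_cst.
exact: csh.
Unshelve. all: by end_near. Qed.
End LocalSquareRoot.

(** * The Wronskian quartic and its invariant *)

(** For the quartic with roots c0, ..., c3 this is e2^2 - 3 e1 e3 + 12 e4, twelve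
times its classical invariant I; up to sign, y and w are the numerator and the
denominator of the cross ratio. It is defined over any commutative ring in order
to be used with c0 the indeterminate. *)
Definition quartic_I (A : comNzRingType) (c0 c1 c2 c3 : A) : A :=
  let y := (c0 - c2) * (c3 - c1) in
  let w := (c0 - c3) * (c1 - c2) in
  y ^+ 2 + y * w + w ^+ 2.

Section Algebra.
Variable K : numFieldType.
Implicit Types (p q g : {poly K}).

Lemma wronskian_mull g p q :
  wronskian (g * p) (g * q) = g ^+ 2 * wronskian p q.
Proof. by rewrite /wronskian !derivM; ring. Qed.

Lemma wronskianC p q : wronskian q p = - wronskian p q.
Proof. by rewrite /wronskian; ring. Qed.

Lemma monic_of_roots p (rs : seq K) :
  p \is monic -> size p = (size rs).+1 -> uniq rs -> all (root p) rs ->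
  p = \prod_(r <- rs) ('X - r%:P).
Proof.
move=> /monicP p1 szp rs_uniq rs_root.
by rewrite [LHS](all_roots_prod_XsubC szp) ?uniq_rootsE // p1 scale1r.
Qed.

Definition quartic (u3 u2 u1 u0 : K) : {poly K} :=
  'X^4 + u3 *: 'X^3 + u2 *: 'X^2 + u1 *: 'X + u0%:P.

Lemma quartic_inj u3 u2 u1 u0 v3 v2 v1 v0 :
  quartic u3 u2 u1 u0 = quartic v3 v2 v1 v0 ->
  [/\ u3 = v3, u2 = v2, u1 = v1 & u0 = v0].
Proof.
move=> /polyP uv.
by split; [move: (uv 3) | move: (uv 2) | move: (uv 1) | move: (uv 0)];
  rewrite /quartic !coefE /= ?(mulr0, mulr1, addr0, add0r).
Qed.

Lemma quartic_Poly u3 u2 u1 u0 : quartic u3 u2 u1 u0 = Poly [:: u0; u1; u2; u3; 1].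
Proof.
by rewrite /quartic /= !cons_poly_def -!mul_polyC; ring.
Qed.

Lemma size_quartic u3 u2 u1 u0 : size (quartic u3 u2 u1 u0) = 5.
Proof. by rewrite quartic_Poly (@PolyK _ 0) ?oner_neq0. Qed.

Lemma monic_quartic u3 u2 u1 u0 : quartic u3 u2 u1 u0 \is monic.
Proof. by rewrite monicE lead_coefE size_quartic quartic_Poly coef_Poly. Qed.

Lemma wronskian_quartic (a0 a1 b0 b1 : K) :
  wronskian ('X^3 + a1 *: 'X + a0%:P) ('X^2 + b1 *: 'X + b0%:P) =
  quartic (2 * b1) (3 * b0 - a1) (- (2 * a0)) (a1 * b0 - a0 * b1).
Proof.
rewrite /wronskian !poly.derivE /= /quartic -!mul_polyC; ring.
Qed.

Lemma prod_quartic (c0 c1 c2 c3 : K) :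
  ('X - c0%:P) * (('X - c1%:P) * (('X - c2%:P) * ('X - c3%:P))) =
  quartic (- (c0 + c1 + c2 + c3))
    (c0 * c1 + c0 * c2 + c0 * c3 + c1 * c2 + c1 * c3 + c2 * c3)
    (- (c0 * c1 * c2 + c0 * c1 * c3 + c0 * c2 * c3 + c1 * c2 * c3))
    (c0 * c1 * c2 * c3).
Proof. by rewrite /quartic -!mul_polyC; ring. Qed.

(** Equality of the coefficients of the Wronskian with those of the monic
quartic with roots c0, ..., c3. *)
Definition vieta (a0 a1 b0 b1 c0 c1 c2 c3 : K) : Prop :=
  [/\ 2 * b1 = - (c0 + c1 + c2 + c3),
      3 * b0 - a1 = c0 * c1 + c0 * c2 + c0 * c3 + c1 * c2 + c1 * c3 + c2 * c3,
      2 * a0 = c0 * c1 * c2 + c0 * c1 * c3 + c0 * c2 * c3 + c1 * c2 * c3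
    & a1 * b0 - a0 * b1 = c0 * c1 * c2 * c3].

Lemma wronskian_vietaP a0 a1 b0 b1 c0 c1 c2 c3 :
  wronskian ('X^3 + a1 *: 'X + a0%:P) ('X^2 + b1 *: 'X + b0%:P) =
    ('X - c0%:P) * (('X - c1%:P) * (('X - c2%:P) * ('X - c3%:P))) <->
  vieta a0 a1 b0 b1 c0 c1 c2 c3.
Proof.
rewrite wronskian_quartic prod_quartic; split.
  by move=> /quartic_inj[? ? /oppr_inj ? ?].
by case=> -> -> -> ->.
Qed.

(** s^2 = (3 b0 - a1)^2 + 12 a1 b0, where 3 b0 - a1 = e2 and
a1 b0 = e4 + a0 b1 = e4 - e1 e3 / 4. *)
Lemma vieta_quartic_I a0 a1 b0 b1 c0 c1 c2 c3 :
  vieta a0 a1 b0 b1 c0 c1 c2 c3 ->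
  (a1 + 3 * b0) ^+ 2 = quartic_I c0 c1 c2 c3.
Proof.
case=> E1 E2 E3 E4.
have -> : (a1 + 3 * b0) ^+ 2 = (3 * b0 - a1) ^+ 2
    + 12 * (a1 * b0 - a0 * b1) + 3 * (2 * a0) * (2 * b1) by ring.
by rewrite E1 E2 E3 E4 /quartic_I; ring.
Qed.

(** The system 3 b0 - a1 = e2, 3 b0 + a1 = s determines a1 and b0; the equation
for e4 then says that s^2 = I. *)
Lemma vieta_of_sqrt c0 c1 c2 c3 s :
  let e2 := c0 * c1 + c0 * c2 + c0 * c3 + c1 * c2 + c1 * c3 + c2 * c3 in
  s ^+ 2 = quartic_I c0 c1 c2 c3 ->
  vieta ((c0 * c1 * c2 + c0 * c1 * c3 + c0 * c2 * c3 + c1 * c2 * c3) / 2)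
    ((s - e2) / 2) ((s + e2) / 6) (- (c0 + c1 + c2 + c3) / 2) c0 c1 c2 c3.
Proof.
move=> e2 sI.
have n2 : (2 : K) != 0 by rewrite pnatr_eq0.
have n6 : (6 : K) != 0 by rewrite pnatr_eq0.
split; rewrite /e2; try by field.
(* The difference of the two sides of the equation for e4 is (s^2 - I) / 12. *)
apply/eqP; rewrite -subr_eq0; apply/eqP.
transitivity ((s ^+ 2 - quartic_I c0 c1 c2 c3) / 12); last by rewrite sI subrr mul0r.
by rewrite /quartic_I; field.
Qed.

Lemma cross_ratio_equianharmonic (c0 c1 c2 c3 D : K) :
  c2 != c1 -> c3 != c0 ->
  D = ((c0 - c2) * (c1 - c3)) / ((c2 - c1) * (c3 - c0)) ->
  (D ^+ 2 - D + 1 == 0) = (quartic_I c0 c1 c2 c3 == 0).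
Proof.
rewrite -(subr_eq0 c2) -(subr_eq0 c3) => c21 c30 ->.
have -> : quartic_I c0 c1 c2 c3 = ((c2 - c1) * (c3 - c0)) ^+ 2 *
  ((((c0 - c2) * (c1 - c3)) / ((c2 - c1) * (c3 - c0))) ^+ 2
   - (((c0 - c2) * (c1 - c3)) / ((c2 - c1) * (c3 - c0))) + 1).
  by rewrite /quartic_I; field; rewrite c21 c30.
by rewrite mulf_eq0 sqrf_eq0 mulf_eq0 (negbTE c21) (negbTE c30).
Qed.
End Algebra.

(** * Higher derivatives in families of rational functions *)

Section RationalDerivatives.
Variable K : numFieldType.
Implicit Types (p q : {poly K}) (z : K).

Lemma near_horner_neq0 q z : q.[z] != 0 -> \forall y \near z, q.[y] != 0.
Proof.
move=> qz.
have qc : {for z, continuous (horner q)}.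
  apply/differentiable_continuous/derivable1_diffP.
  exact: (@ex_derive _ _ _ _ _ _ _ (is_derive_horner q z)).
exact: (cvgr_neq0 _ qc qz).
Qed.

(** Numerator and denominator of the n-th derivative of p / q, unreduced. *)
Definition ratio_deriv (n : nat) p q : {poly K} * {poly K} :=
  iter n (fun pq => (wronskian pq.1 pq.2, pq.2 ^+ 2)) (p, q).

(** The formula for the n-th derivative holds on the whole open set where q is
nonzero, so it may be differentiated again. *)
Lemma derive1n_ratio n p q z : q.[z] != 0 ->
  let pq := ratio_deriv n p q in
  pq.2.[z] != 0 /\ derive1n n (fun y => p.[y] / q.[y]) z = pq.1.[z] / pq.2.[z].
Proof.
elim: n z => [|n IHn] z qz //=; have [den0 _] := IHn z qz.
split; first by rewrite horner_exp expf_neq0.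
rewrite -derive1_ratio // !derive1E; apply: near_eq_derive.
by apply: filterS (near_horner_neq0 qz) => y /IHn[].
Qed.
End RationalDerivatives.

Section PolynomialFamilies.
Variables (K : numFieldType) (V : normedModType K) (x : V).
Implicit Types P Q : V -> {poly K}.

(** All formal derivatives are included so that the notion is stable under
formal differentiation, hence under ratio_deriv. *)
Definition differentiable_poly P : Prop :=
  forall k z, differentiable (fun y => (P y)^`(k).[z]) x.

Lemma differentiable_poly_cst (p : {poly K}) : differentiable_poly (fun=> p).
Proof. by move=> k z; exact: differentiable_cst. Qed.

Lemma differentiable_polyC (f : V -> K) :
  differentiable f x -> differentiable_poly (fun y => (f y)%:P).
Proof.
move=> df [|k] z.
  by under eq_fun do rewrite derivn0 hornerC; exact: df.
under eq_fun do rewrite derivnC /= horner0; exact: differentiable_cst.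
Qed.

Lemma differentiable_polyD P Q : differentiable_poly P ->
  differentiable_poly Q -> differentiable_poly (fun y => P y + Q y).
Proof.
move=> dP dQ k z; under eq_fun do rewrite derivnD hornerD.
exact: (differentiableD (dP k z) (dQ k z)).
Qed.

Lemma differentiable_polyN P :
  differentiable_poly P -> differentiable_poly (fun y => - P y).
Proof.
move=> dP k z; under eq_fun do rewrite derivnN hornerN.
exact: (differentiableN (dP k z)).
Qed.

Lemma differentiable_poly_deriv P :
  differentiable_poly P -> differentiable_poly (fun y => (P y)^`()).
Proof.
by move=> dP k z; under eq_fun do rewrite -derivSn; exact: dP.
Qed.

Lemma differentiable_polyM P Q : differentiable_poly P ->
  differentiable_poly Q -> differentiable_poly (fun y => P y * Q y).
Proof.
move=> dP dQ k; elim: k P Q dP dQ => [|k IHk] P Q dP dQ z.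
  under eq_fun do rewrite derivn0 hornerM.
  exact: (differentiableM (dP 0 z) (dQ 0 z)).
under eq_fun do rewrite derivSn derivM derivnD hornerD.
apply: differentiableD; apply: IHk => //; exact: differentiable_poly_deriv.
Qed.

Lemma differentiable_ratio_deriv n P Q :
    differentiable_poly P -> differentiable_poly Q ->
  differentiable_poly (fun y => (ratio_deriv n (P y) (Q y)).1) /\
  differentiable_poly (fun y => (ratio_deriv n (P y) (Q y)).2).
Proof.
move=> dP dQ; elim: n => [|n [IH1 IH2]]; first by split.
split; last exact: differentiable_polyM.
apply: differentiable_polyD.
  exact: differentiable_polyM (differentiable_poly_deriv IH1) IH2.
apply: differentiable_polyN.
exact: differentiable_polyM IH1 (differentiable_poly_deriv IH2).
Qed.

Lemma differentiable_derive1n_ratio n P Q z :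
    differentiable_poly P -> differentiable_poly Q -> (Q x).[z] != 0 ->
  differentiable (fun y => derive1n n (fun t => (P y).[t] / (Q y).[t]) z) x.
Proof.
move=> dP dQ Qz; have [dN dD] := differentiable_ratio_deriv n dP dQ.
have Qc : {for x, continuous (fun y => (Q y).[z])}.
  exact: (differentiable_continuous (dQ 0 z)).
have [den0 _] := derive1n_ratio n (P x) Qz.
apply: near_eq_differentiable.
  near=> y; apply/esym.
  have Qy : (Q y).[z] != 0 by near: y; exact: (cvgr_neq0 _ Qc Qz).
  by have [_ ->] := derive1n_ratio n (P y) Qy.
exact: (differentiableM (dN 0 z) (differentiableV (dD 0 z) den0)).
Unshelve. all: by end_near. Qed.
End PolynomialFamilies.

(** * Critical vectors *)

(** In the chart 1/w of the target the numerator of the derivative is the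
opposite Wronskian, so both charts give the same condition. *)
Lemma critical_root (K : numFieldType) (p q : {poly K}) z : coprimep p q ->
  (if q.[z] != 0 then derive1 (fun y => p.[y] / q.[y]) z = 0
   else derive1 (fun y => q.[y] / p.[y]) z = 0) <-> root (wronskian p q) z.
Proof.
move=> pq; have num0 u v : v.[z] != 0 ->
    (wronskian u v).[z] / (v ^+ 2).[z] = 0 <-> root (wronskian u v) z.
  move=> vz; rewrite /root; split=> [/eqP|/eqP ->]; last by rewrite mul0r.
  by rewrite horner_exp mulf_eq0 invr_eq0 sqrf_eq0 (negbTE vz) orbF.
case: ifPn => [qz|]; first by rewrite derive1_ratio //; exact: num0.
rewrite negbK => /eqP qz.
have pz : p.[z] != 0.
  by apply: (coprimep_root (q := p) (p := q)); rewrite 1?coprimep_sym // /root qz.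
rewrite derive1_ratio // num0 // wronskianC /root hornerN oppr_eq0.
by [].
Qed.

Section CriticalVector.
Variable R : realType.
Local Notation C := R[i].
Implicit Types (a c : 'rV[C]_4) (p q : {poly C}).

Lemma critical_pointP p q z : q != 0 ->
  critical_point p q z <->
  root (wronskian (p %/ gcdp p q) (q %/ gcdp p q)) z.
Proof.
move=> q0; apply: critical_root.
by apply: coprimep_div_gcd; rewrite q0 orbT.
Qed.

Lemma wronskian_reduced p q : wronskian p q =
  gcdp p q ^+ 2 * wronskian (p %/ gcdp p q) (q %/ gcdp p q).
Proof.
by rewrite -wronskian_mull ![gcdp p q * _]mulrC !divpK ?dvdp_gcdl ?dvdp_gcdr.
Qed.

Definition entries c : seq C := [:: c 0 0; c 0 1; c 0 2; c 0 3].

Lemma entriesP c z : (exists i, z = c 0 i) <-> z \in entries c.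
Proof.
rewrite /entries !inE; split.
  case=> -[[|[|[|[|//]]]] lt_i] ->.
  - by rewrite (_ : Ordinal _ = 0) ?eqxx //; apply/val_inj.
  - by rewrite (_ : Ordinal _ = 1) ?eqxx ?orbT //; apply/val_inj.
  - by rewrite (_ : Ordinal _ = 2) ?eqxx ?orbT //; apply/val_inj.
  - by rewrite (_ : Ordinal _ = 3) ?eqxx ?orbT //; apply/val_inj.
by move=> /or4P[] /eqP ->; eexists.
Qed.

Lemma entries_uniq c : injective (c 0) -> uniq (entries c).
Proof.
move=> c_inj.
have -> : entries c = map (c 0) [:: 0; 1; 2; 3] by [].
by rewrite map_inj_uniq.
Qed.

Lemma entries_prod c : \prod_(r <- entries c) ('X - r%:P) =
  ('X - (c 0 0)%:P) * (('X - (c 0 1)%:P) *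
    (('X - (c 0 2)%:P) * ('X - (c 0 3)%:P))).
Proof. by rewrite /entries !big_cons big_nil mulr1. Qed.

Lemma wronskian_fpar a : wronskian (fnum a) (fden a) =
  quartic (2 * a 0 3) (3 * a 0 2 - a 0 1) (- (2 * a 0 0))
    (a 0 1 * a 0 2 - a 0 0 * a 0 3).
Proof. exact: wronskian_quartic. Qed.

Lemma fden_neq0 a : fden a != 0.
Proof.
apply/eqP => /polyP/(_ 2); rewrite /fden !coefE /= mulr0 !addr0.
by move/eqP; rewrite oner_eq0.
Qed.

(** The Wronskian of the reduced fraction is W / g^2 with g the gcd. From left
to right, the four critical points are roots of W, which is monic of degree 4.
From right to left, W is separable and divisible by g^2, so g is constant. *)
Lemma critical_vectorP a c : critical_vector a c <->
  injective (c 0) /\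
  vieta (a 0 0) (a 0 1) (a 0 2) (a 0 3) (c 0 0) (c 0 1) (c 0 2) (c 0 3).
Proof.
have W_reduced := wronskian_reduced (fnum a) (fden a).
set g := gcdp _ _ in W_reduced.
split=> -[c_inj crit]; split=> //.
  apply/wronskian_vietaP; rewrite -entries_prod.
  apply: (@monic_of_roots _ (wronskian (fnum a) (fden a))).
  - by rewrite wronskian_fpar monic_quartic.
  - by rewrite wronskian_fpar size_quartic.
  - exact: entries_uniq.
  apply/allP => z /entriesP/crit/(critical_pointP _ _ (fden_neq0 a)) W1z.
  by rewrite W_reduced rootM W1z orbT.
move/wronskian_vietaP: crit; rewrite -entries_prod => W_prod z.
have {}W_prod : wronskian (fnum a) (fden a) =
  \prod_(r <- entries c) ('X - r%:P) := W_prod.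
have /eqP/size_poly1P[k k0 gE] : size g = 1.
  apply/eqP; rewrite -coprimepp.
  have : separable_poly (wronskian (fnum a) (fden a)).
    by rewrite W_prod separable_prod_XsubC entries_uniq.
  by case/separable_polyP => + _; apply; rewrite W_reduced dvdp_mulr.
rewrite (critical_pointP _ _ (fden_neq0 a)) -/g (entriesP c).
rewrite -root_prod_XsubC -W_prod W_reduced.
by rewrite rootM gE -polyC_exp rootC expf_eq0 /= (negbTE k0).
Qed.
End CriticalVector.

(** * The Schwarzian of a family of maps *)

Section SchwarzianFamily.
Variable R : realType.
Local Notation C := R[i].
Implicit Types (a c : 'rV[C]_4).

Lemma differentiable_poly_fnum (A : 'rV[C]_4 -> 'rV[C]_4) x :
  differentiable A x -> differentiable_poly x (fun y => fnum (A y)).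
Proof.
move=> dA.
have coef i : differentiable (fun y => A y 0 i) x.
  exact: (differentiable_comp dA (differentiable_coord (A x) 0 i)).
rewrite /fnum; under eq_fun do rewrite -mul_polyC.
apply: differentiable_polyD; last exact: (differentiable_polyC (coef 0)).
apply: differentiable_polyD; first exact: differentiable_poly_cst.
apply: differentiable_polyM; last exact: differentiable_poly_cst.
exact: (differentiable_polyC (coef 1)).
Qed.

Lemma differentiable_poly_fden (A : 'rV[C]_4 -> 'rV[C]_4) x :
  differentiable A x -> differentiable_poly x (fun y => fden (A y)).
Proof.
move=> dA.
have coef i : differentiable (fun y => A y 0 i) x.
  exact: (differentiable_comp dA (differentiable_coord (A x) 0 i)).
rewrite /fden; under eq_fun do rewrite -mul_polyC.
apply: differentiable_polyD; last exact: (differentiable_polyC (coef 2)).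
apply: differentiable_polyD; first exact: differentiable_poly_cst.
apply: differentiable_polyM; last exact: differentiable_poly_cst.
exact: (differentiable_polyC (coef 3)).
Qed.

Lemma differentiable_schwarzian (A : 'rV[C]_4 -> 'rV[C]_4) x z :
    differentiable A x -> (fden (A x)).[z] != 0 ->
    derive1 (fpar (A x)) z != 0 ->
  differentiable (fun y => schwarzian (fpar (A y)) z) x.
Proof.
move=> dA Qz f'z.
have dP := differentiable_poly_fnum dA; have dQ := differentiable_poly_fden dA.
have d1 : differentiable (fun y => derive1 (fpar (A y)) z) x.
  exact: (differentiable_derive1n_ratio 1 dP dQ Qz).
have d2 : differentiable (fun y => derive1n 2 (fpar (A y)) z) x.
  exact: (differentiable_derive1n_ratio 2 dP dQ Qz).
have d3 : differentiable (fun y => derive1n 3 (fpar (A y)) z) x.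
  exact: (differentiable_derive1n_ratio 3 dP dQ Qz).
have dV := differentiableV d1 f'z.
have d2V := differentiableM d2 dV.
have half_sqr := differentiableM
  (differentiable_cst (3 / 2 : C) x) (differentiableM d2V d2V).
exact: (differentiableB (differentiableM d3 dV) half_sqr).
Qed.
End SchwarzianFamily.

(** * Zeros of the invariant *)

(** The derivative of g^2 is 2 g g', which vanishes with g. Thus a polynomial has
no differentiable square root near a simple zero. *)
Lemma square_simple_root (K : numFieldType) (g : K -> K) (p : {poly K}) z :
    derivable g z 1 -> g z = 0 -> (\forall t \near z, g t ^+ 2 = p.[t]) ->
  p^`().[z] = 0.
Proof.
move=> dg gz0 gp; have dp := is_derive_horner p z.
rewrite -[LHS](@derive_val _ _ _ _ _ _ _ dp).
have <- : 'D_1 (g * g) z = 'D_1 (horner p) z by exact: near_eq_derive.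
by rewrite (deriveM dg dg) gz0 !scale0r addr0.
Qed.

(** For a quadratic p = u X^2 + v X + t one has p'^2 = 4 u p + (v^2 - 4 u t);
the last term on the right is the discriminant of I with respect to c0. *)
Lemma sqr_deriv_quartic_I (K : numFieldType) (c0 c1 c2 c3 : K) :
  (quartic_I 'X c1%:P c2%:P c3%:P)^`().[c0] ^+ 2 =
    4 * ((c3 - c1) ^+ 2 + (c3 - c1) * (c1 - c2) + (c1 - c2) ^+ 2) *
      quartic_I c0 c1 c2 c3
    - 3 * ((c1 - c2) * (c2 - c3) * (c3 - c1)) ^+ 2.
Proof.
have -> : quartic_I 'X c1%:P c2%:P c3%:P =
    ((c3 - c1) ^+ 2 + (c3 - c1) * (c1 - c2) + (c1 - c2) ^+ 2)%:P * 'X^2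
    - (2 * c2 * (c3 - c1) ^+ 2 + (c2 + c3) * (c3 - c1) * (c1 - c2)
       + 2 * c3 * (c1 - c2) ^+ 2)%:P * 'X
    + ((c2 * (c3 - c1)) ^+ 2 + c2 * c3 * (c3 - c1) * (c1 - c2)
       + (c3 * (c1 - c2)) ^+ 2)%:P.
  by rewrite /quartic_I; ring.
rewrite derivD derivB derivC !deriv_mulC derivX derivXn /=.
rewrite mulr1 addr0 hornerD hornerN hornerM hornerMn hornerX !hornerC.
by rewrite /quartic_I; ring.
Qed.

Lemma mem_primitive_sixth_roots (K : numClosedFieldType) (j D : K) : j ^+ 2 = -1 ->
  (D \in [:: (1 + j * sqrtC 3) / 2; (1 - j * sqrtC 3) / 2]) =
  (D ^+ 2 - D + 1 == 0).
Proof.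
move=> j2; rewrite !inE -subr_eq0 -[_ == (1 - _) / 2]subr_eq0 -mulf_eq0.
have s2 : sqrtC 3 ^+ 2 = 3 :> K by rewrite sqrtCK.
congr (_ == 0); transitivity (D ^+ 2 - D + (1 - j ^+ 2 * sqrtC 3 ^+ 2) / 4).
  by field.
by rewrite j2 s2; field.
Qed.

(** * The branch of parameters through a given map *)

Section Main.
Variable R : realType.
Local Notation C := R[i].
Implicit Types (a c y : 'rV[C]_4).

Lemma near_injective c :
  injective (c 0) -> \forall y \near c, injective ((y : 'rV[C]_4) 0).
Proof.
move=> c_inj.
have : \forall y \near c, forall ij : 'I_4 * 'I_4,
    ij.1 != ij.2 -> (y : 'rV[C]_4) 0 ij.1 - y 0 ij.2 != 0.
  pose apart (ij : 'I_4 * 'I_4) (y : 'rV[C]_4) :=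
    ij.1 != ij.2 -> y 0 ij.1 - y 0 ij.2 != 0.
  apply: (@filter_forall _ _ apart _ (nbhs_filter c)) => -[i j].
  have [->|ij] := eqVneq i j; first by near=> y; rewrite /apart eqxx.
  have dij := differentiableB (differentiable_coord c 0 i)
                              (differentiable_coord c 0 j).
  have cij0 : c 0 i - c 0 j != 0.
    by rewrite subr_eq0; apply: contra_neq ij; exact: c_inj.
  near=> y => _; near: y.
  exact: (cvgr_neq0 _ (differentiable_continuous dij) cij0).
apply: filterS => y y_neq i j yij; apply/eqP/negPn/negP => ij.
by have /negP[] := y_neq (i, j) ij; rewrite /= yij subrr eqxx.
Unshelve. all: by end_near. Qed.

Definition critical_I y : C := quartic_I (y 0 0) (y 0 1) (y 0 2) (y 0 3).

Lemma differentiable_critical_I c : differentiable critical_I c.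
Proof.
have sub i j := differentiableB (differentiable_coord c 0 i)
                                (differentiable_coord c 0 j).
have dy := differentiableM (sub 0 2) (sub 3 1).
have dw := differentiableM (sub 0 3) (sub 1 2).
exact: (differentiableD (differentiableD (differentiableM dy dy)
  (differentiableM dy dw)) (differentiableM dw dw)).
Qed.

Definition sigma2 y : C :=
  y 0 0 * y 0 1 + y 0 0 * y 0 2 + y 0 0 * y 0 3 +
  y 0 1 * y 0 2 + y 0 1 * y 0 3 + y 0 2 * y 0 3.

Definition sigma3 y : C :=
  y 0 0 * y 0 1 * y 0 2 + y 0 0 * y 0 1 * y 0 3 +
  y 0 0 * y 0 2 * y 0 3 + y 0 1 * y 0 2 * y 0 3.

Lemma differentiable_sigma2 c : differentiable sigma2 c.
Proof.
have mul i j := differentiableM (differentiable_coord c 0 i)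
                                (differentiable_coord c 0 j).
have d2 := differentiableD (mul 0 1) (mul 0 2).
have d3 := differentiableD d2 (mul 0 3).
have d4 := differentiableD d3 (mul 1 2).
exact: (differentiableD (differentiableD d4 (mul 1 3)) (mul 2 3)).
Qed.

Lemma differentiable_sigma3 c : differentiable sigma3 c.
Proof.
have mul i j k := differentiableM (differentiableM
  (differentiable_coord c 0 i) (differentiable_coord c 0 j))
  (differentiable_coord c 0 k).
have d2 := differentiableD (mul 0 1 2) (mul 0 1 3).
exact: (differentiableD (differentiableD d2 (mul 0 2 3)) (mul 1 2 3)).
Qed.

Lemma vec4E (x0 x1 x2 x3 : C) :
  [/\ vec4 x0 x1 x2 x3 0 0 = x0, vec4 x0 x1 x2 x3 0 1 = x1,
      vec4 x0 x1 x2 x3 0 2 = x2 & vec4 x0 x1 x2 x3 0 3 = x3].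
Proof. by split; rewrite mxE. Qed.

Lemma eq_vec4 y : y = vec4 (y 0 0) (y 0 1) (y 0 2) (y 0 3).
Proof.
apply/rowP => -[[|[|[|[|//]]]] lt_i]; rewrite mxE /=.
- by rewrite (_ : Ordinal _ = 0) //; apply/val_inj.
- by rewrite (_ : Ordinal _ = 1) //; apply/val_inj.
- by rewrite (_ : Ordinal _ = 2) //; apply/val_inj.
- by rewrite (_ : Ordinal _ = 3) //; apply/val_inj.
Qed.

Lemma differentiable_vec4 (V : normedModType C) (f0 f1 f2 f3 : V -> C) x :
    differentiable f0 x -> differentiable f1 x ->
    differentiable f2 x -> differentiable f3 x ->
  differentiable (fun t => vec4 (f0 t) (f1 t) (f2 t) (f3 t)) x.
Proof.
move=> d0 d1 d2 d3; apply: differentiable_mx => i [[|[|[|[|//]]]] lt_j];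
  under eq_fun do rewrite mxE /=.
- exact: d0.
- exact: d1.
- exact: d2.
- exact: d3.
Qed.

(** The parameters reconstructed from the critical points and a choice s of the
square root of I. *)
Definition branch (s : 'rV[C]_4 -> C) y : 'rV[C]_4 :=
  vec4 (sigma3 y / 2) ((s y - sigma2 y) / 2) ((s y + sigma2 y) / 6)
    (- (y 0 0 + y 0 1 + y 0 2 + y 0 3) / 2).

Lemma differentiable_branch (s : 'rV[C]_4 -> C) x :
  differentiable s x -> differentiable (branch s) x.
Proof.
move=> ds; have d2 := differentiable_sigma2 x.
have d3 := differentiable_sigma3 x; have co i := differentiable_coord x 0 i.
have d1 := differentiableD (differentiableD (differentiableD
  (co 0) (co 1)) (co 2)) (co 3).
have div (f : 'rV[C]_4 -> C) (k : C) :
    differentiable f x -> differentiable (fun y => f y / k) x.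
  by move=> df; exact: (differentiableM df (differentiable_cst k^-1 x)).
apply: differentiable_vec4; apply: div.
- exact: d3.
- exact: (differentiableB ds d2).
- exact: (differentiableD ds d2).
- exact: (differentiableN d1).
Qed.

Lemma critical_branch (s : 'rV[C]_4 -> C) y :
  injective (y 0) -> s y ^+ 2 = critical_I y -> critical_vector (branch s y) y.
Proof.
move=> y_inj sy; apply/critical_vectorP; split=> //.
have [-> -> -> ->] := vec4E (sigma3 y / 2) ((s y - sigma2 y) / 2)
  ((s y + sigma2 y) / 6) (- (y 0 0 + y 0 1 + y 0 2 + y 0 3) / 2).
exact: (vieta_of_sqrt sy).
Qed.

Lemma branch_center a c (s : 'rV[C]_4 -> C) :
    critical_vector a c -> s c = a 0 1 + 3 * a 0 2 -> branch s c = a.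
Proof.
move=> /critical_vectorP[_ [E1 E2 E3 E4]] sc.
have n2 : (2 : C) != 0 by rewrite pnatr_eq0.
have n6 : (6 : C) != 0 by rewrite pnatr_eq0.
rewrite [RHS]eq_vec4 /branch sc /sigma2 /sigma3 -E1 -E2 -E3.
by congr (vec4 _ _ _ _); field.
Qed.

Lemma holomorphic_of_neq0 a c :
    critical_vector a c -> a 0 1 + 3 * a 0 2 != 0 ->
  schwarzian_locally_holomorphic a c.
Proof.
move=> crit s0N0; set s0 := (X in X != 0) in s0N0.
have s0E : s0 ^+ 2 = critical_I c.
  by have /critical_vectorP[_ v] := crit; exact: (vieta_quartic_I v).
pose s y := sqrt_near s0 (critical_I y).
have critical_I_cvg : {for c, continuous critical_I}.
  exact: (differentiable_continuous (differentiable_critical_I c)).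
have ds : \forall y \near c, differentiable s y.
  have near_sqrt := near_derivable_sqrt_near s0N0; rewrite s0E in near_sqrt.
  have : \forall y \near c, derivable (sqrt_near s0) (critical_I y) 1.
    exact: critical_I_cvg near_sqrt.
  apply: filterS => y /derivable1_diffP dy.
  exact: (differentiable_comp (differentiable_critical_I y) dy).
have dA : \forall y \near c, differentiable (branch s) y.
  by apply: filterS ds => y; exact: differentiable_branch.
exists (branch s); split.
- by apply: (branch_center crit); rewrite /s -s0E sqrt_near_center.
- exact: dA.
- have c_inj : injective (c 0) by have [] := crit.
  apply: filterS (near_injective c_inj) => y y_inj.
  by apply: critical_branch => //; exact: sqr_sqrt_near.
apply: filterS dA => y dAy z; exact: differentiable_schwarzian.
Qed.

(** Moving the first critical point alone, a1 + 3 b0 becomes a differentiable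
square root of the polynomial I(X, c1, c2, c3), whose zero c0 would be simple. *)
Lemma neq0_of_holomorphic a c :
  schwarzian_locally_holomorphic a c -> critical_vector a c ->
  a 0 1 + 3 * a 0 2 != 0.
Proof.
move=> [A [Ac dA critA _]] crit; apply/eqP => a0.
have c_inj : injective (c 0) by have [] := crit.
pose line (t : C) := vec4 t (c 0 1) (c 0 2) (c 0 3).
have line_c : line (c 0 0) = c by rewrite [RHS]eq_vec4.
have dline : differentiable line (c 0 0).
  apply: differentiable_vec4; try exact: differentiable_cst.
  by apply/derivable1_diffP; exact: derivable_id.
pose g t := A (line t) 0 1 + 3 * A (line t) 0 2.
pose p : {poly C} := quartic_I 'X (c 0 1)%:P (c 0 2)%:P (c 0 3)%:P.
have dg : derivable g (c 0 0) 1.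
  apply/derivable1_diffP.
  have dAc : differentiable A (line (c 0 0)).
    by rewrite line_c; exact: (nbhs_singleton dA).
  have dAl := differentiable_comp dline dAc.
  have co i := differentiable_comp dAl (differentiable_coord (A (line (c 0 0))) 0 i).
  exact: (differentiableD (co 1)
    (differentiableM (differentiable_cst (3 : C) (c 0 0)) (co 2))).
have gp : \forall t \near c 0 0, g t ^+ 2 = p.[t].
  have : \forall t \near c 0 0, critical_vector (A (line t)) (line t).
    have line_cvg : line @ c 0 0 --> c.
      by rewrite -[X in _ --> X]line_c; exact: (differentiable_continuous dline).
    exact: line_cvg critA.
  apply: filterS => t /critical_vectorP[_ /vieta_quartic_I gE].
  rewrite /g gE; have [-> -> -> ->] := vec4E t (c 0 1) (c 0 2) (c 0 3).
  rewrite /p /quartic_I.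
  by rewrite !(hornerD, hornerN, hornerM, horner_exp, hornerX, hornerC).
have g0 : g (c 0 0) = 0 by rewrite /g line_c Ac.
have p'0 := square_simple_root dg g0 gp.
have I0 : quartic_I (c 0 0) (c 0 1) (c 0 2) (c 0 3) = 0.
  have /critical_vectorP[_ v] := crit.
  by rewrite -(vieta_quartic_I v) a0 expr0n.
have := sqr_deriv_quartic_I (c 0 0) (c 0 1) (c 0 2) (c 0 3).
rewrite -/p p'0 I0 mulr0 expr0n sub0r => /eqP; rewrite eq_sym oppr_eq0.
have sub_neq0 (i j : 'I_4) : i != j -> c 0 i - c 0 j != 0.
  by move=> ij; rewrite subr_eq0; apply: contra_neq ij; exact: c_inj.
by rewrite !(mulf_eq0, sqrf_eq0) pnatr_eq0 /= !(negbTE (sub_neq0 _ _ _)).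
Qed.
End Main.

Theorem theorem1p4 (R : realType) (a0 a1 b0 b1 : R[i]) (c : 'rV[R[i]]_4) :
  critical_vector (vec4 a0 a1 b0 b1) c ->
  (schwarzian_locally_holomorphic (vec4 a0 a1 b0 b1) c <-> a1 + 3 * b0 != 0) /\
  (a1 + 3 * b0 != 0 <->
   cross_ratio (c 0 0) (c 0 1) (c 0 2) (c 0 3) \notin
     [:: (1 + 'i * sqrtC 3) / 2; (1 - 'i * sqrtC 3) / 2]).
Proof.
move=> crit; have [_ a1E b0E _] := vec4E a0 a1 b0 b1.
split.
  have := @neq0_of_holomorphic R _ _ ^~ crit.
  have := holomorphic_of_neq0 crit.
  by rewrite a1E b0E => ? ?; split.
have /critical_vectorP[c_inj /vieta_quartic_I] := crit; rewrite a1E b0E => IE.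
rewrite mem_primitive_sixth_roots; last by rewrite sqrCi.
rewrite (@cross_ratio_equianharmonic _ (c 0 0) (c 0 1) (c 0 2) (c 0 3)) //.
- by rewrite -IE sqrf_eq0.
- by apply/eqP => /c_inj.
- by apply/eqP => /c_inj.
Qed.
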